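(* Let $p$ be a prime. For $i\geq 0$, let $\sigma_i$ be the generator of the Galois group of $L_i$ over $L_{i-1}$ given by $x\mapsto x^{p^{p^i}}$. Then $\{a_i,\sigma_i(a_i),\dots,\sigma_i^{p-1}(a_i)\}$ is a basis for $L_i$ over $L_{i-1}$.
   Context: Fix a prime $p$ and an algebraic closure $E$ of $\mathbb{F}_p$. Put $c_{-1}=1$ and, recursively for $i\geq -1$, let $c_{i+1}\in E$ be any chosen root of $X^p-X-(c_{-1}c_0\cdots c_i)^{p-1}$. Put $L_{-1}=\mathbb{F}_p$, and for $i\geq -1$ put $L_{i+1}=L_i[c_{i+1}]$ and $a_i=(c_{-1}c_0\cdots c_i)^{p-1}$. One has $[L_{i+1}:L_i]=p$ and $|L_i|=p^{p^{i+1}}$ for all $i\geq -1$. *)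

(* Defs.v *)
From HB Require Import structures.
From mathcomp Require Import all_boot all_order all_algebra.

Set Implicit Arguments.
Unset Strict Implicit.
Unset Printing Implicit Defensive.

Import GRing.Theory.
Local Open Scope ring_scope.

(* An algebraic closure E of F_p has infinite degree,
   so it carries no vectType structure and the subfields L_i are represented
   as Prop-valued subsets of E.

   All sequences are shifted by one because the tower starts at index -1:
   c n, tower_a p c n and tower_L iota c n stand for
   c_(n-1), a_(n-1) and L_(n-1) respectively. *)

(* E, with structure map iota, is an algebraic closure of F; algebraic
   closedness is carried by the type of E. *)
Definition is_algebraic_closure (F : fieldType) (E : closedFieldType)
    (iota : {rmorphism F -> E}) : Prop :=
  forall x : E, algebraicOver iota x.

Definition adjoin (E : fieldType) (K : E -> Prop) (c : E) : E -> Prop :=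
  fun x => exists2 q : {poly E}, (forall k, K q`_k) & x = q.[c].

Definition tower_a (E : fieldType) (p : nat) (c : nat -> E) (n : nat) : E :=
  (\prod_(j < n.+1) c j) ^+ p.-1.

Definition is_tower_seq (E : fieldType) (p : nat) (c : nat -> E) : Prop :=
  c 0%N = 1 /\
  forall n, root ('X^p - 'X - (tower_a p c n)%:P) (c n.+1).

Fixpoint tower_L (F E : fieldType) (iota : {rmorphism F -> E})
    (c : nat -> E) (n : nat) : E -> Prop :=
  match n with
  | 0%N => fun x => exists y : F, x = iota y
  | m.+1 => adjoin (tower_L iota c m) (c m.+1)
  end.

(* This index is not shifted: sigma p i is sigma_i. *)
Definition sigma (E : fieldType) (p i : nat) (x : E) : E := x ^+ (p ^ (p ^ i))%N.

(* tau restricts to a field automorphism of M fixing K pointwise.  The values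
   of tau outside M are irrelevant; injectivity on M is automatic for a
   subfield M. *)
Definition in_gal (E : fieldType) (K M : E -> Prop) (tau : E -> E) : Prop :=
  [/\ forall x, M x -> M (tau x),
      forall y, M y -> exists2 x, M x & tau x = y,
      forall x y, M x -> M y ->
        tau (x + y) = tau x + tau y /\ tau (x * y) = tau x * tau y,
      tau 1 = 1
    & forall x, K x -> tau x = x].

(* Nonnegative powers suffice: the group is finite for a finite extension. *)
Definition gal_generator (E : fieldType) (K M : E -> Prop) (s : E -> E) : Prop :=
  in_gal K M s /\
  forall tau, in_gal K M tau ->
    exists k : nat, forall x, M x -> tau x = iter k s x.

Definition is_basis_over (E : fieldType) (K M : E -> Prop) (n : nat)
    (e : 'I_n -> E) : Prop :=
  [/\ forall j, M (e j),
      forall x, M x ->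
        exists2 k : 'I_n -> E, (forall j, K (k j)) & x = \sum_j k j * e j
    & forall k : 'I_n -> E, (forall j, K (k j)) ->
        \sum_j k j * e j = 0 -> forall j, k j = 0].

(* Main.v *)
(* Going up the tower one sees that [sigma_i] fixes
   [L_(i-1)] and sends [c_i] to [c_i + t] with [t = (-1) ^ i], the absolute
   trace of [a_(i-1)].  A Galois automorphism moves [c_i] to another root
   [c_i + j] of [X ^ p - X - a_(i-1)], with [j] in [F_p], hence is a power of
   [sigma_i].  The conjugates of [a_i] are [a_(i-1) (c_i + k t) ^ (p - 1)],
   and the polynomials [(X + k t) ^ (p - 1)] behave like a Lagrange basis:
   at [X = - j t] the [k]-th one is [0] if [k = j] and [1] otherwise.
   Interpolation at the points [- j t] thus makes them a basis of the
   polynomials of degree less than [p].  A polynomial over [L_(i-1)] that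
   vanishes at [c_i] vanishes at its [p] conjugates, so evaluation at [c_i]
   is injective on degrees less than [p]. *)

Require Import Defs.
From HB Require Import structures.
From mathcomp Require Import all_boot all_order all_algebra.
From mathcomp Require Import finfield.

Set Implicit Arguments.
Unset Strict Implicit.
Unset Printing Implicit Defensive.

Import GRing.Theory.
Local Open Scope ring_scope.

(** * Subrings as predicates, and adjunction of an element *)

Definition is_subring (E : fieldType) (K : E -> Prop) : Prop :=
  [/\ K 1, forall x y, K x -> K y -> K (x - y)
    & forall x y, K x -> K y -> K (x * y)].

Section Subrings.

Context (E : fieldType) (K : E -> Prop) (hK : is_subring K).

Lemma subring0 : K 0.
Proof. by case: hK => h1 hB _; rewrite -(subrr 1); apply: hB. Qed.

Lemma subringN x : K x -> K (- x).
Proof.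
move=> hx; case: hK => _ hB _; rewrite -sub0r.
by apply: hB => //; exact: subring0.
Qed.

Lemma subringD x y : K x -> K y -> K (x + y).
Proof.
move=> hx hy; case: hK => _ hB _; rewrite -(opprK y).
by apply: hB => //; apply: subringN.
Qed.

Lemma subringMn x n : K x -> K (x *+ n).
Proof.
move=> hx; elim: n => [|n IHn]; first exact: subring0.
by rewrite mulrS; apply: subringD.
Qed.

Lemma subringX x n : K x -> K (x ^+ n).
Proof.
move=> hx; case: hK => h1 _ hM; elim: n => [|n IHn]; first by rewrite expr0.
by rewrite exprS; apply: hM.
Qed.

Lemma subring_sum (I : Type) (r : seq I) (P : pred I) (F : I -> E) :
  (forall i, K (F i)) -> K (\sum_(i <- r | P i) F i).
Proof. by move=> hF; apply: big_ind => //; [exact: subring0 | exact: subringD]. Qed.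

Lemma adjoin_subring c : is_subring (adjoin K c).
Proof.
case: hK => h1 hB hM; split.
- exists 1; last by rewrite hornerC.
  by move=> k; rewrite coef1; apply: subringMn.
- move=> _ _ [q hq ->] [r hr ->]; exists (q - r); last by rewrite !hornerE.
  by move=> k; rewrite coefB; apply: hB.
- move=> _ _ [q hq ->] [r hr ->]; exists (q * r); last by rewrite !hornerE.
  by move=> k; rewrite coefM; apply: subring_sum => i; apply: hM.
Qed.

Lemma sub_adjoin c x : K x -> adjoin K c x.
Proof.
move=> hx; exists x%:P; last by rewrite hornerC.
by move=> k; rewrite coefC; case: eqP => // _; exact: subring0.
Qed.

Lemma mem_adjoin c : adjoin K c c.
Proof.
by exists 'X; [move=> k; rewrite coefX; apply: subringMn; case: hK | rewrite hornerX].
Qed.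

Lemma subring_horner (q : {poly E}) x : (forall k, K q`_k) -> K x -> K q.[x].
Proof.
move=> hq hx; rewrite horner_coef; apply: subring_sum => i.
by case: hK => _ _; apply=> //; apply: subringX.
Qed.

End Subrings.

(** Since [tau] is additive and multiplicative only on [M], the induction follows Horner's scheme
    and keeps every intermediate value in [M]. *)
Lemma fixed_horner (E : fieldType) (K M : E -> Prop) (tau : E -> E) (c : E)
    (q : {poly E}) :
  is_subring M -> (forall x, K x -> M x) -> M c ->
  (forall x y, M x -> M y ->
     tau (x + y) = tau x + tau y /\ tau (x * y) = tau x * tau y) ->
  tau 0 = 0 -> (forall x, K x -> tau x = x) ->
  (forall k, K q`_k) -> tau q.[c] = q.[tau c].
Proof.
move=> hM KM Mc tauDM tau0 tauK; elim/poly_ind: q => [|q k IHq] hq.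
  by rewrite !horner0.
have hq' j : K q`_j.
  by have := hq j.+1; rewrite coefD coefMX coefC /= addr0.
have hk : K k by have := hq 0%N; rewrite coefD coefMX coefC /= add0r.
have Mq : M q.[c] by apply: subring_horner => // j; apply: (KM).
have MqX : M (q.[c] * c) by case: hM => _ _; apply.
rewrite !hornerMXaddC (tauDM _ _ MqX (KM _ hk)).1 (tauDM _ _ Mq Mc).2.
by rewrite IHq // (tauK k).
Qed.

(** * Shifts by multiples of [t] and the powers [(X + k t) ^ (p - 1)] *)

Section PrimeShifts.

Context (p : nat) (hp : prime p) (E : fieldType) (pE : p \in [pchar E]).
Context (t : E) (tp : t ^+ p = t) (t0 : t != 0).

Lemma pchar_expD n x y : (x + y : E) ^+ (p ^ n) = x ^+ (p ^ n) + y ^+ (p ^ n).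
Proof. by apply: exprDn_pchar; rewrite (eq_pnat _ (pcharf_eq pE)) pnatX pnat_id. Qed.

Lemma pchar_expN n x : (- x : E) ^+ (p ^ n) = - (x ^+ (p ^ n)).
Proof. by apply: exprNn_pchar; rewrite (eq_pnat _ (pcharf_eq pE)) pnatX pnat_id. Qed.

Lemma pchar_exp_sum n (I : Type) (r : seq I) (F : I -> E) :
  (\sum_(i <- r) F i) ^+ (p ^ n) = \sum_(i <- r) F i ^+ (p ^ n).
Proof.
apply: (big_morph (fun x => x ^+ (p ^ n)) (pchar_expD n)).
by rewrite expr0n expn_eq0 (negPf (lt0n_neq0 (prime_gt0 hp))).
Qed.

Lemma shift_exp k : (t *+ k) ^+ p = t *+ k.
Proof.
rewrite -mulr_natr exprMn tp; congr (_ * _).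
by rewrite -(pFrobenius_autE pE) pFrobenius_aut_nat.
Qed.

Lemma shift_inj (j k : 'I_p) : t *+ j = t *+ k -> j = k.
Proof.
wlog le_jk : j k / (j <= k)%N.
  by move=> W; case/orP: (leq_total j k) => [/W|/W h /esym/h] //.
move=> /esym/eqP; rewrite -subr_eq0 -mulrnBr // -mulr_natr mulf_eq0 (negPf t0) /=.
rewrite -(dvdn_pcharf pE) => /dvdn_leq h; apply/val_inj/eqP.
rewrite eqn_leq le_jk /= -subn_eq0 -leqn0 leqNgt; apply/negP => /[dup] d0 /h.
by rewrite leqNgt (leq_ltn_trans (leq_subr _ _)).
Qed.

(** A difference [d] of multiples of [t] satisfies [d ^ p = d]; when [d] is nonzero, one factor
    cancels. *)
Lemma shift_expB (j k : 'I_p) : (t *+ k - t *+ j) ^+ p.-1 = (k != j)%:R.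
Proof.
have p1 : (0 < p.-1)%N by rewrite -subn1 subn_gt0 prime_gt1.
have [->|kj] := eqVneq k j; first by rewrite subrr expr0n gtn_eqF.
have d0 : t *+ k - t *+ j != 0.
  by rewrite subr_eq0; apply: contraNneq kj => /shift_inj ->.
apply: (mulfI d0); rewrite -exprS prednK ?prime_gt0 // mulr1.
by have := pchar_expD 1 (t *+ k) (- (t *+ j)); rewrite pchar_expN expn1 !shift_exp.
Qed.

Lemma shift_poly0 (x : E) (q : {poly E}) :
  (size q <= p)%N -> (forall k : 'I_p, q.[x + t *+ k] = 0) -> q = 0.
Proof.
move=> sq hq; apply/eqP/negP => /negP q0.
have := @max_poly_roots _ q [seq x + t *+ (k : 'I_p) | k : 'I_p] q0.
rewrite size_image card_ord ltnNge sq => h; suff: false by []. apply: h.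
  by apply/allP => _ /imageP[k _ ->]; apply/rootP.
by rewrite map_inj_uniq ?enum_uniq // => j k /addrI/shift_inj.
Qed.

(* The value of the combination at [- j t] is the sum of all weights except
   the [j]-th, because [d ^ (p - 1) = 1] on nonzero multiples of [t]. *)
Lemma shift_comb_horner (w : 'I_p -> E) (j : 'I_p) :
  (\sum_(k < p) w k *: ('X + (t *+ k)%:P) ^+ p.-1).[- (t *+ j)]
    = \sum_k w k - w j.
Proof.
rewrite horner_sum (bigD1 j) //= [in RHS](bigD1 j) //= [w j + _]addrC.
rewrite addrK !hornerE addNr expr0n gtn_eqF ?mulr0 ?add0r; last first.
  by rewrite -subn1 subn_gt0 prime_gt1.
by apply: eq_bigr => k kj; rewrite !hornerE addrC shift_expB kj mulr1.
Qed.

Lemma shift_comb_size (w : 'I_p -> E) :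
  (size (\sum_(k < p) w k *: ('X + (t *+ k)%:P) ^+ p.-1)%R <= p)%N.
Proof.
apply: (leq_trans (size_sum _ _ _)); apply/bigmax_leqP => k _.
apply: (leq_trans (size_scale_leq _ _)).
apply: (leq_trans (size_poly_exp_leq _ _)).
by rewrite size_XaddC /= mul1n prednK // prime_gt0.
Qed.

Lemma sum_const_pchar (x : E) : \sum_(k < p) x = 0.
Proof. by rewrite sumr_const card_ord -mulr_natr (pcharf0 pE) mulr0. Qed.

(** Evaluation at [- j t] shows that each weight equals the sum of all weights. The weights are thus
    constant, and [p] equal terms sum to zero. *)
Lemma shift_comb_eq0 (w : 'I_p -> E) :
  \sum_(k < p) w k *: ('X + (t *+ k)%:P) ^+ p.-1 = 0 -> forall j, w j = 0.
Proof.
move=> w0 j; have wS i : w i = \sum_k w k.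
  by have := shift_comb_horner w i; rewrite w0 horner0 => /esym/subr0_eq ->.
by rewrite wS (eq_bigr (fun=> w j)) ?sum_const_pchar // => k _; rewrite !wS.
Qed.

Lemma shift_polyP (q r : {poly E}) :
  (size q <= p)%N -> (size r <= p)%N ->
  (forall j : 'I_p, q.[- (t *+ j)] = r.[- (t *+ j)]) -> q = r.
Proof.
(* Substituting [- X] turns the nodes [- j t] into [j t], so that [shift_poly0] applies with base
   point [0]. *)
move=> sq sr qr; suff h : (q - r) \Po (- 'X) = 0.
  apply/subr0_eq; rewrite -[LHS]comp_polyXr.
  have -> : 'X = (- 'X) \Po (- 'X) :> {poly E} by rewrite raddfN /= comp_polyX opprK.
  by rewrite comp_polyA h comp_poly0.
apply: (@shift_poly0 0); last first.
  by move=> k; rewrite horner_comp !hornerE qr subrr.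
rewrite size_comp_poly2 ?size_polyN ?size_polyX //.
by rewrite (leq_trans (size_polyD _ _)) // geq_max sq size_polyN.
Qed.

(** Let [S] be the sum of the values of [q] at the nodes. Weights [C - q (- j t)] sum to [- S] for
    any constant [C], because [p C = 0]. The combination then takes the value [- S - C + q (- j t)]
    at [- j t], whence the choice [C = - S]. *)
Lemma shift_comb_interp (q : {poly E}) (w : 'I_p -> E) :
  (size q <= p)%N ->
  (forall j, w j = - \sum_(k < p) q.[- (t *+ k)] - q.[- (t *+ j)]) ->
  q = \sum_(k < p) w k *: ('X + (t *+ k)%:P) ^+ p.-1.
Proof.
move=> sq hw; apply: shift_polyP => // [|j]; first exact: shift_comb_size.
rewrite shift_comb_horner (eq_bigr _ (fun k _ => hw k)) big_split /=.
rewrite sum_const_pchar add0r sumrN hw.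
by rewrite opprD opprK addrA addNr add0r opprK.
Qed.

(** Interpolating the constant [- 1] yields all weights equal to [1], since its values at the [p]
    nodes sum to zero. *)
Lemma shift_sum_exp (x : E) : \sum_(k < p) (x + t *+ k) ^+ p.-1 = - 1.
Proof.
have := @shift_comb_interp (- 1) (fun=> 1).
rewrite size_polyN size_poly1 prime_gt0 // => /(_ isT) h.
have {h}/(congr1 (fun r => r.[x])) :
    - 1 = \sum_(k < p) 1 *: ('X + (t *+ k)%:P) ^+ p.-1 :> {poly E}.
  apply: h => j; rewrite !hornerE opprK.
  rewrite (eq_bigr (fun=> - 1)) => [|k _]; last by rewrite !hornerE.
  by rewrite sum_const_pchar oppr0 add0r.
rewrite horner_sum !hornerE => ->.
by apply: eq_bigr => k _; rewrite !hornerE.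
Qed.

(** * Bases of an extension generated by a root of [X ^ p - X - a] *)

Lemma adjoin_reduce (K : E -> Prop) (c a : E) :
  is_subring K -> K a -> c ^+ p = c + a ->
  forall x, adjoin K c x ->
    exists q : {poly E}, [/\ (size q <= p)%N, forall k, K q`_k & x = q.[c]].
Proof.
move=> hK Ka cp _ [q + ->]; have p1 := prime_gt1 hp; case: (hK) => K1 KB KM.
elim/poly_ind: q => [|q k IHq] hq.
  by exists 0; rewrite size_poly0; split=> // k; rewrite coef0; exact: subring0.
have [|r [sr Kr qr]] := IHq.
  by move=> j; have := hq j.+1; rewrite coefD coefMX coefC /= addr0.
have Kk : K k by have := hq 0%N; rewrite coefD coefMX coefC /= add0r.
(* The product by [X] may reach degree [p]; a multiple of the polynomial that vanishes at [c]
   cancels its top coefficient. *)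
exists (r * 'X + k%:P - r`_p.-1 *: ('X^p - 'X - a%:P)); split.
- apply/leq_sizeP => j pj.
  have j1 : (1 < j)%N by apply: leq_trans pj.
  rewrite !coefE /= !(gtn_eqF j1) (gtn_eqF (ltnW j1)) !subr0 addr0.
  have [->|jp] := eqVneq j p; first by rewrite mulr1 subrr.
  rewrite mulr0 subr0 (leq_sizeP _ _ sr) // -ltnS prednK ?(ltnW j1) //.
  by rewrite ltn_neqAle eq_sym jp.
- move=> j; rewrite !coefE.
  apply: (KB); first apply: subringD => //.
  + by case: ifP => // _; exact: subring0.
  + by case: ifP => // _; exact: subring0.
  apply: (KM) => //; apply: (KB); last by case: ifP => // _; exact: subring0.
  by apply: (KB); apply: subringMn.
- by rewrite hornerMXaddC qr !hornerE cp (addrC c) addrK subrr mulr0 subr0.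
Qed.

(** In the tower [b] is [a n], a unit of [K] that only rescales the weights. The last hypothesis
    stands in for the irreducibility of [X ^ p - X - a]: it makes evaluation at [c] injective below
    degree [p]. *)
Lemma shift_basis (K : E -> Prop) (c a b : E) :
  is_subring K -> K a -> c ^+ p = c + a -> K t -> K b -> K b^-1 -> b != 0 ->
  (forall q : {poly E}, (forall k, K q`_k) -> q.[c] = 0 ->
     forall k, q.[c + t *+ k] = 0) ->
  is_basis_over K (adjoin K c) (fun k : 'I_p => b * (c + t *+ k) ^+ p.-1).
Proof.
move=> hK Ka cp Kt Kb KVb b0 conj; case: (hK) => K1 KB KM.
have [_ _ MM] := adjoin_subring hK c.
have combE w : (\sum_(k < p) w k *: ('X + (t *+ k)%:P) ^+ p.-1).[c]
    = \sum_(k < p) w k * (c + t *+ k) ^+ p.-1.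
  by rewrite horner_sum; apply: eq_bigr => k _; rewrite !hornerE.
split.
- move=> k; apply: (MM); first exact: sub_adjoin.
  apply: subringX; first exact: adjoin_subring.
  apply: subringD; [exact: adjoin_subring | exact: mem_adjoin |].
  by apply: sub_adjoin => //; apply: subringMn.
- move=> _ /(adjoin_reduce hK Ka cp)[q [sq Kq ->]].
  pose w j := - \sum_(k < p) q.[- (t *+ k)] - q.[- (t *+ j)].
  have Kv k : K q.[- (t *+ k)].
    by apply: subring_horner => //; apply: subringN => //; apply: subringMn.
  have Kw j : K (w j).
    by apply: (KB) => //; apply: subringN => //; apply: subring_sum => // k.
  exists (fun j => w j * b^-1) => [j|]; first exact: KM.
  rewrite {1}(@shift_comb_interp q (fun j => w j)) // combE.
  by apply: eq_bigr => j _; rewrite -mulrA mulKf.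
- move=> w Kw w0; apply: shift_comb_eq0; apply: (@shift_poly0 c).
    exact: shift_comb_size.
  move=> k; apply: conj => [j|].
    rewrite coef_sum; apply: subring_sum => // i; rewrite coefZ; apply: (KM) => //.
    have KX m : forall j, K (('X + (t *+ i)%:P) ^+ m)`_j.
      elim: m => [|m IHm] l; first by rewrite expr0 coef1; apply: subringMn.
      rewrite exprS mulrDl coefD coefXM coefCM; apply: subringD => //.
        by case: ifP => // _; exact: subring0.
      by apply: (KM) => //; apply: subringMn.
    exact: KX.
  apply: (mulfI b0); rewrite mulr0 combE mulr_sumr -[RHS]w0.
  by apply: eq_bigr => i _; rewrite mulrCA.
Qed.

End PrimeShifts.

(** Otherwise [d] and the [p] elements of the prime field would be [p + 1] roots of [X - X ^ p]. *)
Lemma pchar_exp_fixed (p : nat) (E : fieldType) (d : E) :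
  prime p -> p \in [pchar E] -> d ^+ p = d -> exists k : nat, d = k%:R.
Proof.
move=> hp pE dp.
have [/existsP[k /eqP ->]|] := boolP [exists k : 'I_p, d == k%:R].
  by exists k.
rewrite negb_exists => /forallP hd; exfalso.
have s1 : size ('X - 'X^p : {poly E}) = p.+1.
  rewrite -size_polyN opprB size_polyDl size_polyXn //.
  by rewrite size_polyN size_polyX ltnS prime_gt1.
have := @max_poly_roots _ ('X - 'X^p) (d :: [seq (val k)%:R | k : 'I_p]).
rewrite -size_poly_eq0 s1 /= size_image card_ord ltnn; move=> h; suff: false by [].
apply: h => //.
  apply/andP; split; first by rewrite rootE !hornerE dp subrr.
  apply/allP => _ /imageP[k _ ->]; rewrite rootE !hornerE.
  by rewrite -(pFrobenius_autE pE) pFrobenius_aut_nat subrr.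
apply/andP; split.
  by apply/imageP => -[k _ dk]; have := hd k; rewrite dk eqxx.
rewrite map_inj_uniq ?enum_uniq // => j k.
exact: (shift_inj pE (oner_neq0 E)).
Qed.

(** * The tower and its nonzero elements [a n] *)

Section Tower.

Context (p : nat) (hp : prime p) (E : closedFieldType).
Context (iota : {rmorphism 'F_p -> E}) (c : nat -> E) (hc : is_tower_seq p c).

Local Notation L := (tower_L iota c).
Local Notation a := (tower_a p c).

Lemma tower_pchar : p \in [pchar E].
Proof. exact: (rmorph_pchar iota (pchar_Fp hp)). Qed.

Local Notation pE := tower_pchar.

Lemma tower_root n : c n.+1 ^+ p = c n.+1 + a n.
Proof.
have /rootP := hc.2 n; rewrite !hornerE => /subr0_eq/eqP.
by rewrite subr_eq addrC => /eqP.
Qed.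

Lemma tower_aS n : a n.+1 = a n * c n.+1 ^+ p.-1.
Proof. by rewrite /tower_a big_ord_recr exprMn. Qed.

Lemma tower_a0 : a 0 = 1.
Proof. by rewrite /tower_a big_ord1 hc.1 expr1n. Qed.

Lemma tower_a_neq0 n : a n != 0.
Proof.
elim: n => [|n IHn]; first by rewrite tower_a0 oner_eq0.
rewrite tower_aS mulf_neq0 // expf_neq0 //.
(* If [c n.+1] were zero, its defining equation would give [a n = 0]. *)
apply: contraNneq IHn => c0; have := tower_root n.
by rewrite c0 add0r expr0n (negPf (lt0n_neq0 (prime_gt0 hp))) => <-.
Qed.

Lemma tower_subring n : is_subring (L n).
Proof.
elim: n => [|n IHn]; last exact: adjoin_subring.
split; first by exists 1; rewrite rmorph1.
- by move=> _ _ [x ->] [y ->]; exists (x - y); rewrite rmorphB.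
- by move=> _ _ [x ->] [y ->]; exists (x * y); rewrite rmorphM.
Qed.

Lemma tower_sub n x : L n x -> L n.+1 x.
Proof. by apply: sub_adjoin; exact: tower_subring. Qed.

Lemma tower_a_mem n : L n (a n).
Proof.
elim: n => [|n IHn]; first by rewrite tower_a0; case: (tower_subring 0).
rewrite tower_aS; case: (tower_subring n.+1) => _ _; apply; first exact: tower_sub.
apply: subringX; first exact: tower_subring.
by apply: mem_adjoin; exact: tower_subring.
Qed.

(** * Powers of the Frobenius along the tower *)

Lemma iter_sigma n k (x : E) : iter k (sigma p n) x = x ^+ (p ^ (p ^ n * k)).
Proof.
elim: k => [|k IHk]; first by rewrite muln0 expn0 expr1.
by rewrite iterS IHk /sigma -exprM -expnD mulnS addnC.
Qed.

(** Each iteration of the additive map [x |-> x ^ (p ^ m)] adds one more image of [u], so the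
    displacement of [x] is a partial trace of [u]. *)
Lemma exp_iter_shift m u (x : E) k : x ^+ (p ^ m) = x + u ->
  x ^+ (p ^ (m * k)) = x + \sum_(j < k) u ^+ (p ^ (m * j)).
Proof.
move=> hx; elim: k => [|k IHk].
  by rewrite muln0 expn0 expr1 big_ord0 addr0.
rewrite mulnS expnD exprM hx (pchar_expD hp pE) IHk big_ord_recr /=.
by rewrite addrA.
Qed.

(** Additivity of the Frobenius gives [(-1) ^ p = -1] for every [p], including [p = 2]. *)
Lemma sign_exp n : ((-1) ^+ n : E) ^+ p = (-1) ^+ n.
Proof.
rewrite -exprM mulnC exprM; congr (_ ^+ _).
by have := pchar_expN hp pE 1 1; rewrite expn1 expr1n.
Qed.

Lemma sigmaD n x y : sigma p n (x + y : E) = sigma p n x + sigma p n y.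
Proof. exact: (pchar_expD hp pE (p ^ n)%N). Qed.

Lemma sigmaM n x y : sigma p n (x * y : E) = sigma p n x * sigma p n y.
Proof. exact: exprMn. Qed.

Lemma sigma0 n : sigma p n (0 : E) = 0.
Proof. by rewrite /sigma expr0n expn_eq0 (negPf (lt0n_neq0 (prime_gt0 hp))). Qed.

Lemma sigma_sign n m : sigma p n ((-1) ^+ m : E) = (-1) ^+ m.
Proof.
rewrite /sigma; elim: (p ^ n)%N => [|k IHk]; first by rewrite expn0 expr1.
by rewrite expnS exprM sign_exp.
Qed.

Lemma iter_shift n (u : E) k x :
  sigma p n x = x + u -> sigma p n u = u -> iter k (sigma p n) x = x + u *+ k.
Proof.
move=> hx hu; elim: k => [|k IHk]; first by rewrite addr0.
rewrite iterS IHk sigmaD hx mulrS -addrA; congr (_ + (_ + _)).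
elim: {IHk} k => [|k IHk]; first exact: sigma0.
by rewrite mulrS sigmaD hu IHk.
Qed.

Lemma iter_sigma_horner n k (q : {poly E}) x :
  (forall j, sigma p n q`_j = q`_j) ->
  iter k (sigma p n) q.[x] = q.[iter k (sigma p n) x].
Proof.
move=> hq; elim: k => // k IHk; rewrite !iterS IHk.
apply: (@fixed_horner _ (fun y => sigma p n y = y) (fun=> True)) => //.
  by move=> y z _ _; rewrite sigmaD sigmaM.
exact: sigma0.
Qed.

(* Summing the conjugates [c_(n+1) + k t] to the power [p - 1] gives [- 1], so
   the relative trace of [a (n+1)] is [- a n]; composed down the tower, the
   absolute trace of [a n] is [(-1) ^ n], and that is the amount by which
   [sigma_n] moves [c (n+1)]. *)
Lemma tower_sigma n :
  (forall x, L n x -> sigma p n x = x) /\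
  sigma p n (c n.+1) = c n.+1 + (-1) ^+ n.
Proof.
elim: n => [|n [fixL shift]].
  split; last by rewrite /sigma expn0 expn1 tower_root tower_a0.
  move=> _ [y ->]; rewrite /sigma expn0 expn1 -rmorphXn; congr (iota _).
  by have := expf_card y; rewrite card_Fp.
have t0 : (-1) ^+ n != 0 :> E by rewrite signr_eq0.
have conj k : iter k (sigma p n) (c n.+1) = c n.+1 + (-1) ^+ n *+ k.
  by apply: iter_shift => //; exact: sigma_sign.
have iterE (x : E) : sigma p n.+1 x = iter p (sigma p n) x.
  by rewrite iter_sigma /sigma expnSr.
have iterA k : iter k (sigma p n) (a n) = a n.
  by elim: k => // k IHk; rewrite iterS IHk fixL //; exact: tower_a_mem.
split.
  move=> _ [q hq ->]; rewrite iterE.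
  rewrite iter_sigma_horner; last by move=> k; exact: fixL (hq k).
  (* The [p] shifts by [(-1) ^ n] add up to zero, so [sigma p n.+1] fixes [c n.+1]. *)
  by rewrite conj -mulr_natr (pcharf0 pE) mulr0 addr0.
have traceE m (x : E) j : x ^+ p = x + j ->
    x ^+ (p ^ m) = x + \sum_(i < m) j ^+ (p ^ i).
  move=> hx; rewrite -{1}[m]mul1n (@exp_iter_shift 1 j); last by rewrite expn1.
  by congr (_ + _); apply: eq_bigr => i _; rewrite mul1n.
have step := exp_iter_shift p (traceE (p ^ n)%N _ _ (tower_root n.+1)).
rewrite /sigma expnSr {}step; congr (_ + _).
under eq_bigr => l _ do rewrite (pchar_exp_sum hp pE).
(* After the exchange, the inner sum is the relative trace of [a n.+1], raised to the power
   [p ^ i]. *)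
rewrite exchange_big /=.
have tr (i : 'I_(p ^ n)) : \sum_(l < p) (a n.+1 ^+ (p ^ i)) ^+ (p ^ (p ^ n * l))
    = - (a n ^+ (p ^ i)).
  under eq_bigr => l _ do rewrite exprAC.
  rewrite -(pchar_exp_sum hp pE) -(pchar_expN hp pE); congr (_ ^+ _).
  rewrite -[RHS]mulrN1 -(shift_sum_exp hp pE (sign_exp n) t0 (c n.+1)) mulr_sumr.
  apply: eq_bigr => l _; rewrite tower_aS exprMn [c _ ^+ _ ^+ _]exprAC.
  by rewrite -!iter_sigma iterA conj.
rewrite (eq_bigr _ (fun i _ => tr i)) sumrN exprS mulN1r; congr (- _).
(* The remaining sum is the displacement of [c n.+1] under [sigma p n], known by induction. *)
by apply: (addrI (c n.+1)); rewrite -shift /sigma (traceE _ _ _ (tower_root n)).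
Qed.

Lemma tower_fixed n x : L n x -> sigma p n x = x.
Proof. exact: (tower_sigma n).1. Qed.

Lemma tower_conj n k :
  iter k (sigma p n) (c n.+1) = c n.+1 + (-1) ^+ n *+ k.
Proof.
by apply: iter_shift; [exact: (tower_sigma n).2 | exact: sigma_sign].
Qed.

Lemma iter_sigma_p n x : L n.+1 x -> iter p (sigma p n) x = x.
Proof. by move=> Lx; rewrite iter_sigma -expnSr; exact: (tower_fixed Lx). Qed.

Lemma sign_mem n m : L n ((-1) ^+ m).
Proof.
have hL := tower_subring n; apply: subringX => //; apply: subringN => //.
by case: hL.
Qed.

(** With [q = p ^ (p ^ n)], the identity [x ^ q = x] makes the inverse of a nonzero [x] the power
    [x ^ (q - 2)], which a subring contains. *)
Lemma tower_inv_mem n x : L n x -> L n x^-1.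
Proof.
move=> Lx; have [->|x0] := eqVneq x 0.
  by rewrite invr0; exact: subring0 (tower_subring n).
have p1 : (1 < p ^ (p ^ n))%N.
  by rewrite -{1}(expn0 p) ltn_exp2l ?prime_gt1 // expn_gt0 prime_gt0.
suff -> : x^-1 = x ^+ (p ^ (p ^ n) - 2).
  by apply: subringX Lx; exact: tower_subring.
apply: (mulfI x0); apply: (mulfI x0); rewrite divff // mulr1 -!exprS.
by rewrite -[X in x ^+ X]addn2 subnK //; exact: esym (tower_fixed Lx).
Qed.

(** * Galois group and conjugate basis at each level *)

Lemma sigma_in_gal n : in_gal (L n) (L n.+1) (sigma p n).
Proof.
have hS := tower_subring n.+1.
split=> [x Lx|y Ly|x y _ _||x Lx].
- exact: subringX.
(* The [p]-th iterate is the identity on [L n.+1], so the [(p - 1)]-th one inverts [sigma p n]. *)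
- exists (iter p.-1 (sigma p n) y); first by rewrite iter_sigma; apply: subringX.
  by rewrite -iterS prednK ?prime_gt0 // iter_sigma_p.
- by rewrite sigmaD sigmaM.
- exact: expr1n.
- exact: tower_fixed.
Qed.

Lemma tower_gal_generator n : gal_generator (L n) (L n.+1) (sigma p n).
Proof.
split=> [|tau [tauM _ tauDM tau1 tauK]]; first exact: sigma_in_gal.
have hL := tower_subring n; have hS := tower_subring n.+1.
have Mc : L n.+1 (c n.+1) by apply: mem_adjoin.
have tau0 : tau 0 = 0 by apply: tauK; exact: subring0.
have tauE (q : {poly E}) : (forall j, L n q`_j) -> tau q.[c n.+1] = q.[tau (c n.+1)].
  exact: (@fixed_horner _ (L n) (L n.+1) tau (c n.+1) q hS (@tower_sub n)).
have tauX m : tau (c n.+1 ^+ m) = tau (c n.+1) ^+ m.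
  have := tauE 'X^m; rewrite !hornerE; apply=> j; rewrite coefXn.
  by apply: subringMn => //; case: hL.
set t : E := (-1) ^+ n.
have tp : t ^+ p = t := sign_exp n.
have tt : t * t = 1 by rewrite -expr2 sqrr_sign.
(* Both [c n.+1] and its image are roots of the same equation, so their difference is fixed by the
   Frobenius. The factor [t], its own inverse, expresses that difference as [k t], the shift made by
   the [k]-th iterate of [sigma p n]. *)
have [k hk] : exists k : nat, t * (tau (c n.+1) - c n.+1) = k%:R.
  apply: (pchar_exp_fixed hp pE); rewrite exprMn tp; congr (_ * _).
  have := pchar_expD hp pE 1 (tau (c n.+1)) (- c n.+1).
  rewrite (pchar_expN hp pE) expn1 => ->; rewrite -tauX !tower_root.
  rewrite (tauDM _ _ Mc (tower_sub (tower_a_mem n))).1 (tauK _ (tower_a_mem n)).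
  by rewrite opprD addrACA subrr addr0.
have tauc : tau (c n.+1) = iter k (sigma p n) (c n.+1).
  by rewrite tower_conj -mulr_natr -hk mulrA tt mul1r addrC subrK.
exists k => _ [q hq ->]; rewrite tauE // iter_sigma_horner ?tauc // => j.
exact: tower_fixed (hq j).
Qed.

Lemma tower_basis n :
  is_basis_over (L n) (L n.+1)
    (fun k : 'I_p => iter k (sigma p n) (a n.+1)).
Proof.
have La := tower_a_mem n.
have eqf (k : 'I_p) : a n * (c n.+1 + (-1) ^+ n *+ k) ^+ p.-1
    = iter k (sigma p n) (a n.+1).
  rewrite tower_aS -tower_conj; elim: (val k) => // m IHm.
  by rewrite !iterS -IHm sigmaM (tower_fixed La) /sigma [_ ^+ _ ^+ p.-1]exprAC.
have [||Mf span indep] := shift_basis hp pE (sign_exp n) _ (tower_subring n) La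
  (tower_root n) (sign_mem n n) La (tower_inv_mem La) (tower_a_neq0 n).
- by rewrite signr_eq0.
(* The iterates of [sigma p n] fix the coefficients of [q], hence carry its root [c n.+1] to
   roots. *)
- move=> q hq q0 k; rewrite -tower_conj -iter_sigma_horner.
    rewrite q0; elim: k => // k IHk.
    by rewrite iterS IHk sigma0.
  by move=> j; exact: tower_fixed (hq j).
split.
- by move=> k; rewrite -eqf; exact: Mf.
- move=> x /span[w Kw ->]; exists w => //.
  by apply: eq_bigr => j _; rewrite eqf.
- move=> w Kw w0; apply: indep => //; rewrite -[RHS]w0.
  by apply: eq_bigr => j _; rewrite eqf.
Qed.

End Tower.

Theorem theorem5p1 (p : nat) (hp : prime p)
    (E : closedFieldType) (iota : {rmorphism 'F_p -> E})
    (hE : is_algebraic_closure iota)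
    (c : nat -> E) (hc : is_tower_seq p c) (i : nat) :
  gal_generator (tower_L iota c i) (tower_L iota c i.+1) (sigma p i) /\
  is_basis_over (tower_L iota c i) (tower_L iota c i.+1)
    (fun k : 'I_p => iter k (sigma p i) (tower_a p c i.+1)).
Proof. by split; [exact: tower_gal_generator | exact: tower_basis]. Qed.
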